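(* Let $\lambda\neq1$, let $p_0,\dots,p_d$ be probability densities with respect to $\nu$ for which the $\lambda$-mixture family $\{p(\cdot;\eta)\}$ is well defined, and suppose $p_0>0$. Put $\lambda'=1-\lambda$ and $q'=1-\lambda'=\lambda$. Then the $\lambda$-mixture family is, after a reparameterization, a $\lambda'$-exponential family, and hence a $q'$-exponential family. That is, there exist a reference measure $\nu'$ and a vector of $d$ statistics $G=(G_1,\dots,G_d)$ (not depending on $\eta$) and one-to-one maps $\eta\mapsto\vartheta\in\mathbb{R}^d$ and $\eta\mapsto\theta\in\mathbb{R}^d$ such that, for every mixture parameter $\eta$, the distribution $p(\cdot;\eta)\,d\nu$ has density with respect to $\nu'$ equal to $$\exp_{q'}(\vartheta\cdot G(x))\,e^{-\varphi_{\lambda'}(\vartheta)}=\exp_{q'}(\theta\cdot G(x)-\phi_{q'}(\theta)),$$ where $\varphi_{\lambda'}(\vartheta)\in\mathbb{R}$ and $\phi_{q'}(\theta)\in\mathbb{R}$ are determined by normalization.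
   Context: The escort transformation with exponent $a\neq0$ is $\mathcal{E}_a[p]=p^a/\int p^a\,d\nu$ (when $\int p^a\,d\nu$ is finite). $\lambda$-mixture family ($\lambda\neq1$, $q=1-\lambda$) with respect to densities $p_0,\dots,p_d$: with $\widetilde p_i=\mathcal{E}_q[p_i]$, $$p(\cdot;\eta)=\mathcal{E}_{1/q}\Big[\sum_{i=0}^d\eta_i\widetilde p_i\Big]=\frac{\left(\sum_{i=0}^d\eta_i\widetilde p_i\right)^{1/q}}{\int\left(\sum_{j=0}^d\eta_j\widetilde p_j\right)^{1/q}d\nu},\qquad\eta_i\ge0,\ \sum_{i=0}^d\eta_i=1;$$ it is well defined when all the integrals involved converge. For $q'\neq1$ and $\lambda'=1-q'$, $\exp_{q'}(t)=[1+\lambda't]_+^{1/\lambda'}$ with $t_+=\max\{t,0\}$ and $0^s=\infty$ for $s<0$. A $\lambda'$-exponential family with statistics $G$ and reference measure $\nu'$ consists of densities $\exp_{q'}(\vartheta\cdot G(x))e^{-\varphi_{\lambda'}(\vartheta)}$ with $\varphi_{\lambda'}(\vartheta)=\log\int\exp_{q'}(\vartheta\cdot G)\,d\nu'$; a $q'$-exponential family consists of densities $\exp_{q'}(\theta\cdot G(x)-\phi_{q'}(\theta))$ with $\phi_{q'}(\theta)$ determined by $\int\exp_{q'}(\theta\cdot G-\phi_{q'}(\theta))\,d\nu'=1$. *)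

(* Defs.v *)
From HB Require Import structures.
From mathcomp Require Export all_boot all_order all_algebra.
From mathcomp Require Export all_classical all_reals all_analysis.

Set Implicit Arguments.
Unset Strict Implicit.
Unset Printing Implicit Defensive.
Import Order.TTheory GRing.Theory Num.Theory.
Import numFieldNormedType.Exports.

Local Open Scope classical_set_scope.
Local Open Scope ring_scope.

(* x^s for x in [0, +oo] and s <> 0, with 0^s = +oo and (+oo)^s = 0 for s < 0.
   The library's poweR cannot be used alone: for s < 0 it has 0 `^ s = 0 and
   +oo `^ s = +oo. *)
Definition xpow (R : realType) (x : \bar R) (s : R) : \bar R :=
  if s < 0 then ((poweR x (- s))^-1)%E else poweR x s.

Definition is_density (d : measure_display) (T : measurableType d)
    (R : realType) (nu : {measure set T -> \bar R}) (p : T -> R) : Prop :=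
  [/\ measurable_fun [set: T] p,
      (forall x, 0 <= p x) &
      (\int[nu]_x (p x)%:E = 1)%E].

Definition escort (d : measure_display) (T : measurableType d) (R : realType)
    (nu : {measure set T -> \bar R}) (a : R) (f : T -> \bar R) : T -> \bar R :=
  fun x => (xpow (f x) a / \int[nu]_y xpow (f y) a)%E.

Definition simplex (R : realType) (n : nat) : set 'rV[R]_n.+1 :=
  [set eta | (forall i, 0 <= eta 0 i) /\ \sum_i eta 0 i = 1].

Section Mixture.
Context (d : measure_display) (T : measurableType d) (R : realType).
Context (nu : {measure set T -> \bar R}) (lambda : R) (n : nat).
Context (p : 'I_n.+1 -> T -> R).

Let q : R := 1 - lambda.

Definition escort_mixture (eta : 'rV[R]_n.+1) : T -> \bar R :=
  fun x => (\sum_i (eta 0 i)%:E * escort nu q (EFin \o p i) x)%E.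

Definition lambda_mixture (eta : 'rV[R]_n.+1) : T -> \bar R :=
  escort nu q^-1 (escort_mixture eta).

Definition lambda_mixture_well_defined : Prop :=
  (forall i, (\int[nu]_x xpow (p i x)%:E q < +oo)%E) /\
  (forall eta, simplex eta ->
     (\int[nu]_x xpow (escort_mixture eta x) q^-1 < +oo)%E).

End Mixture.

(* For 1 - q < 0 the value is +oo where the bracket vanishes. *)
Definition qexp (R : realType) (q t : R) : \bar R :=
  xpow (Num.max (1 + (1 - q) * t) 0)%:E (1 - q)^-1.

Definition dot (R : realType) (n : nat) (u : 'rV[R]_n) (v : 'I_n -> R) : R :=
  \sum_i u 0 i * v i.

Section ExponentialFamilies.
Context (d : measure_display) (T : measurableType d) (R : realType).
Context (nu : {measure set T -> \bar R}) (n : nat) (G : 'I_n -> T -> R).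

Definition lambda_potential (lambda : R) (theta : 'rV[R]_n) : \bar R :=
  lne (\int[nu]_x qexp (1 - lambda) (dot theta (G ^~ x)))%E.

Definition lambda_exp_density (lambda : R) (theta : 'rV[R]_n) (phi : R) :
    T -> \bar R :=
  fun x => (qexp (1 - lambda) (dot theta (G ^~ x)) * (expR (- phi))%:E)%E.

Definition q_exp_density (q : R) (theta : 'rV[R]_n) (phi : R) : T -> \bar R :=
  fun x => qexp q (dot theta (G ^~ x) - phi).

Definition is_q_potential (q : R) (theta : 'rV[R]_n) (phi : R) : Prop :=
  (\int[nu]_x q_exp_density q theta phi x = 1)%E.

End ExponentialFamilies.

(* Main.v *)
(* Write q = 1 - lambda and let a_i be the escort density of p_i. Since the
   weights sum to 1, [sum_i eta_i a_i = a_0 (1 + q sum_(i >= 1) eta_i G_i)] with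
   [G_i = (a_i / a_0 - 1) / q], and [a_0^(1/q)] is proportional to p_0. Taking
   nu' = p_0 nu, the power 1/q of the mixture is thus the deformed exponential
   of [vartheta . G] with vartheta = (eta_1, ..., eta_d). Absorbing the factor
   [e^(-phi)] in the bracket gives the second form, with
   [theta = e^(-q phi) vartheta] and [phi_q = (1 - e^(-q phi)) / q]. Injectivity
   of theta follows from uniqueness of phi_q: theta determines phi_q, hence phi,
   hence vartheta. For q < 0 an a_i may be infinite, but only on a nu-null set,
   where the real-valued G_i takes a junk value. *)
From HB Require Import structures.
Require Import Defs.
From mathcomp Require Import all_boot all_order all_algebra.
From mathcomp Require Import all_classical all_reals all_analysis.
From mathcomp Require Import measurable_realfun ring.
Set Implicit Arguments.
Unset Strict Implicit.
Unset Printing Implicit Defensive.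
Import Order.TTheory GRing.Theory Num.Theory.
Import numFieldNormedType.Exports.
Local Open Scope classical_set_scope.
Local Open Scope ring_scope.

(** * Extended-real powers and the deformed exponential *)

Section XPow.
Variable R : realType.
Implicit Types (x : \bar R) (a b c s t l phi : R).

Lemma xpow_ge0 x s : (0 <= xpow x s)%E.
Proof.
by rewrite /xpow; case: ifP => _; rewrite ?inve_ge0 poweR_ge0.
Qed.

Lemma xpow_gt0E a s : 0 < a -> xpow a%:E s = (a `^ s)%:E.
Proof.
move=> a0; rewrite /xpow; case: ifP => _ //.
by rewrite poweR_EFin inver powR_eq0 gt_eqF//= powRN invrK.
Qed.

Lemma xpow0 s : s != 0 -> xpow 0%:E s = if s < 0 then +oo%E else 0%E.
Proof.
move=> s0; rewrite /xpow; case: ifP => _; last by rewrite poweR0r.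
by rewrite poweR0r ?oppr_eq0// inve0.
Qed.

(** The two powers differ only at [a = 0] with [s < 0], where [powR] defaults to 0; finiteness
    excludes exactly this case. *)
Lemma xpow_fin a s : s != 0 -> 0 <= a -> (xpow a%:E s < +oo)%E ->
  xpow a%:E s = (a `^ s)%:E.
Proof.
move=> s0; rewrite le_eqVlt => /predU1P[<-|/xpow_gt0E //].
by rewrite xpow0// powR0//; case: ifP.
Qed.

Lemma xpow_eq0 a s : 0 <= a -> xpow a%:E s = 0%E -> a = 0.
Proof.
move=> a0; rewrite /xpow; case: ifP => _; last first.
  by move=> /poweR_eq0_eq0; rewrite lee_fin => /(_ a0)[].
by move=> /eqP; rewrite inve_eq0 poweR_EFin.
Qed.

Lemma xpowM a b s : s != 0 -> 0 < a -> 0 <= b ->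
  xpow (a * b)%:E s = ((a `^ s)%:E * xpow b%:E s)%E.
Proof.
move=> s0 a0; rewrite le_eqVlt => /predU1P[<-|b0].
  rewrite mulr0 xpow0//; case: ifP => _; last by rewrite mule0.
  by rewrite gt0_muley// lte_fin powR_gt0.
by rewrite !xpow_gt0E ?mulr_gt0// powRM ?ltW.
Qed.

Lemma lt_xpow_pos a b s : 0 < s -> 0 <= a -> a < b ->
  (xpow a%:E s < xpow b%:E s)%E.
Proof.
move=> s0 a0 ab; rewrite /xpow (le_gtF (ltW s0)) !poweR_EFin lte_fin.
by apply: gt0_ltr_powR => //; rewrite nnegrE// (le_trans a0)// ltW.
Qed.

Lemma lt_xpow_neg a b s : s < 0 -> 0 <= a -> a < b ->
  (xpow b%:E s < xpow a%:E s)%E.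
Proof.
move=> s0 a0 ab; rewrite /xpow s0 !poweR_EFin.
rewrite lte_pV2 ?inE ?lee_fin ?powR_ge0// lte_fin.
by apply: gt0_ltr_powR; rewrite ?oppr_gt0// nnegrE// (le_trans a0)// ltW.
Qed.

Lemma measurable_xpow s : measurable_fun [set: \bar R] (fun x => xpow x s).
Proof.
rewrite /xpow; have [s0|s0] := ltP s 0; last exact: measurable_poweR.
pose y x := poweR x (- s).
have my : measurable_fun setT y by exact: measurable_poweR.
(* The extended inverse is split at 0 and [+oo], leaving a real power with exponent -1, whose
   measurability is known. *)
rewrite (_ : (fun _ => _) = fun x => if y x == 0 then +oo%E
    else if y x == +oo%E then 0%E else ((fine (y x)) `^ (-1))%:E).
  apply: measurable_fun_ifT => //=; first exact: measurable_fun_eqe.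
  apply: measurable_fun_ifT => //=; first exact: measurable_fun_eqe.
  apply/measurable_EFinP/(measurableT_comp (measurable_powR _)) => //.
  exact: measurableT_comp.
apply/funext => x; rewrite -/(y x).
have : (0 <= y x)%E by exact: poweR_ge0.
case: (y x) => [r||] //=.
by rewrite lee_fin inver eqe => r0; case: ifP => //; rewrite powR_inv1.
Qed.

Lemma qexp_compl l t : qexp (1 - l) t = xpow (Num.max (1 + l * t) 0)%:E l^-1.
Proof. by rewrite /qexp subKr. Qed.

Lemma qexp_ge0 l t : (0 <= qexp l t)%E.
Proof. exact: xpow_ge0. Qed.

(** For [l < 0] the bracket decreases in the argument, but so does the power [l^-1], so the
    composite increases for either sign. Strictness fails only where both brackets are truncated;
    the common value is then 0 or [+oo], and the equation g + g = g covers both at once. *)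
Lemma qexp_lt l s t : l != 0 -> s < t ->
  (qexp (1 - l) s < qexp (1 - l) t)%E \/
  (qexp (1 - l) s = qexp (1 - l) t /\
   (qexp (1 - l) s + qexp (1 - l) s = qexp (1 - l) s)%E).
Proof.
move=> l0 st; rewrite !qexp_compl.
set a := 1 + l * s; set b := 1 + l * t.
have [[l_gt0 ab]|[l_lt0 ba]] : (0 < l /\ a < b) \/ (l < 0 /\ b < a).
- have [l_lt0|l_gt0|/eqP] := ltgtP l 0; last by rewrite (negPf l0).
    by right; rewrite ltrD2l ltr_nM2l.
  by left; rewrite ltrD2l ltr_pM2l.
(* The larger bracket decides: if it is nonpositive, both truncate to 0. For [l > 0] this is [b] and
   the common value is 0; for [l < 0] it is [a] and the common value is [+oo]. *)
- have [b0|b0] := leP b 0.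
    right; rewrite !max_r ?(le_trans (ltW ab))//.
    by rewrite xpow0 ?invr_eq0// ltNge invr_ge0 ltW//= adde0.
  left; apply: lt_xpow_pos; first by rewrite invr_gt0.
    by rewrite le_max lexx orbT.
  by rewrite gt_max ab b0.
- have [a0|a0] := leP a 0.
    right; rewrite !max_r ?(le_trans (ltW ba))//.
    by rewrite xpow0 ?invr_eq0// invr_lt0 l_lt0.
  left; apply: lt_xpow_neg; first by rewrite invr_lt0.
    by rewrite le_max lexx orbT.
  by rewrite gt_max ba a0.
Qed.

Lemma qexp_le l s t : l != 0 -> s < t -> (qexp (1 - l) s <= qexp (1 - l) t)%E.
Proof. by move=> l0 /(qexp_lt l0)[/ltW|[->]]. Qed.

(** A factor e^(-phi) outside the power 1/l is a factor e^(-l phi) on the bracket; the new argument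
    t' solves 1 + l t' = e^(-l phi) (1 + l t). *)
Lemma qexp_mul_expR l t phi : l != 0 ->
  (qexp (1 - l) t * (expR (- phi))%:E)%E =
  qexp (1 - l) (expR (- (l * phi)) * t - (1 - expR (- (l * phi))) / l).
Proof.
move=> l0; rewrite !qexp_compl; set e := expR (- (l * phi)).
have e0 : 0 < e by exact: expR_gt0.
have -> : 1 + l * (e * t - (1 - e) / l) = e * (1 + l * t) by field.
have -> : Num.max (e * (1 + l * t)) 0 = e * Num.max (1 + l * t) 0.
  by rewrite maxr_pMr ?mulr0// ltW.
rewrite xpowM ?invr_eq0// ?le_max ?lexx ?orbT//.
rewrite muleC; congr (_%:E * _)%E.
by rewrite /e -expRM; congr expR; field.
Qed.

End XPow.

(** * Measures given by a density *)

Import HBNNSimple.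

(** The measure f mu, built without assuming [f] integrable; [g] may take the value [+oo]. The
    formula passes from indicators to simple functions by linearity, to nonnegative functions by
    monotone convergence, and to subsets by restriction. *)
Lemma exists_density_measure d (T : measurableType d) (R : realType)
    (mu : {measure set T -> \bar R}) (f : T -> R) :
  measurable_fun [set: T] f -> (forall x, 0 <= f x) ->
  exists nu : {measure set T -> \bar R},
    forall A g, measurable A -> measurable_fun [set: T] g ->
      (forall x, 0 <= g x)%E ->
      (\int[nu]_(x in A) g x = \int[mu]_(x in A) ((f x)%:E * g x))%E.
Proof.
move=> mf0 f0'.
have mf : measurable_fun setT (EFin \o f) by exact/measurable_EFinP.
have f0 x : (0 <= (f x)%:E)%E by rewrite lee_fin.
pose m A := (\int[mu]_(x in A) (f x)%:E)%E.
have m0 : m set0 = 0%E by rewrite /m integral_set0.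
have m_ge0 A : (0 <= m A)%E by exact: integral_ge0.
have m_sigma : semi_sigma_additive m.
  move=> /= F mF tF mUF; rewrite /m; apply: cvg_toP.
    apply: ereal_nondecreasing_is_cvgn => i j ij.
    by apply: lee_sum_nneg_natr => // k _ _; exact: integral_ge0.
  by rewrite ge0_integral_bigcup//=; exact: measurable_funTS.
have [nu nuE] : exists nu : {measure set T -> \bar R}, forall A, nu A = m A.
  pose nuM := isMeasure.Build _ _ _ m m0 m_ge0 m_sigma.
  by exists (HB.pack_for {measure set T -> \bar R} m nuM).
exists nu.
have nu_indic E : measurable E ->
    (\int[nu]_x (\1_E x)%:E = \int[mu]_x ((f x)%:E * (\1_E x)%:E))%E.
  move=> mE; rewrite integral_indic// setIT nuE /m integral_mkcond.
  apply: eq_integral => x _; rewrite patchE indicE.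
  by case: (x \in E); rewrite ?mule1 ?mule0.
have nu_nnsfun (h : {nnsfun T >-> R}) :
    (\int[nu]_x (h x)%:E = \int[mu]_x ((f x)%:E * (h x)%:E))%E.
  under [LHS]eq_integral do rewrite fimfunE -fsumEFin//.
  rewrite [LHS]ge0_integral_fsum//; last 2 first.
  - by move=> r; exact/measurable_EFinP/measurableT_comp.
  - by move=> n x _; rewrite EFinM nnfun_muleindic_ge0.
  under [RHS]eq_integral.
    move=> x xD; rewrite fimfunE -fsumEFin// ge0_mule_fsumr; last first.
      by move=> r; rewrite EFinM nnfun_muleindic_ge0.
    over.
  rewrite [RHS]ge0_integral_fsum//; last 2 first.
  - move=> r; apply: emeasurable_funM => //.
    by apply/measurable_EFinP; apply/measurableT_comp.
  - by move=> n x _; rewrite mule_ge0// EFinM nnfun_muleindic_ge0.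
  apply: eq_fsbigr => r; rewrite inE => -[x _ hxr].
  (* Only values [r] attained by [h] are summed, so [r] is nonnegative and can be pulled out of both
     integrals. *)
  have r0 : 0 <= r by rewrite -hxr.
  under [LHS]eq_integral do rewrite EFinM.
  under [RHS]eq_integral do rewrite EFinM muleCA.
  rewrite ge0_integralZl//; last exact/measurable_EFinP.
  rewrite nu_indic// ge0_integralZl//.
  - by apply: emeasurable_funM => //; exact/measurable_EFinP.
  - by move=> y _; rewrite mule_ge0// lee_fin.
have nu_T g : measurable_fun setT g -> (forall x, 0 <= g x)%E ->
    (\int[nu]_x g x = \int[mu]_x ((f x)%:E * g x))%E.
  move=> mg g0; pose g_ := nnsfun_approx measurableT mg.
  transitivity (limn (fun n => \int[nu]_x (g_ n x)%:E))%E.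
    rewrite -monotone_convergence//=.
    - apply: eq_integral => ? /[!inE] xD; apply/esym/cvg_lim => //=.
      exact: cvg_nnsfun_approx.
    - by move=> n; exact/measurable_EFinP/measurable_funTS.
    - by move=> n ? _; rewrite lee_fin.
    - by move=> ? _ ? ? mn; rewrite lee_fin; exact/lefP/nd_nnsfun_approx.
  transitivity (limn (fun n => \int[mu]_x ((f x)%:E * (g_ n x)%:E)))%E.
    by apply: congr_lim; apply/funext => n; exact: nu_nnsfun.
  rewrite -monotone_convergence//=.
  - apply: eq_integral => x _; apply/cvg_lim => //.
    by apply: cvgeZl => //; exact: cvg_nnsfun_approx.
  - move=> n; apply: emeasurable_funM => //.
    exact/measurable_EFinP/measurable_funTS.
  - by move=> n x _; rewrite mule_ge0// lee_fin.
  - move=> x _ i j ij; rewrite lee_wpmul2l// lee_fin.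
    exact/lefP/nd_nnsfun_approx.
move=> A g mA mg g0; rewrite [LHS]integral_mkcond [RHS]integral_mkcond nu_T.
- apply: eq_integral => x _; rewrite !patchE.
  by case: (x \in A); rewrite ?mule0.
- exact/(measurable_restrictT _ mA)/measurable_funTS.
- by move=> x; rewrite patchE; case: ifP.
Qed.

(** * Ordered functions with equal integrals *)

Section Integration.
Context d (T : measurableType d) (R : realType).
Variable mu : {measure set T -> \bar R}.
Implicit Types f g : T -> \bar R.

(** If the integrals differed on some [E], adding those over the complement would make the totals
    differ too; the finite total allows this addition to stay strict. *)
Lemma le_integral_ae_eq f g :
  measurable_fun [set: T] f -> measurable_fun [set: T] g ->
  (forall x, 0 <= f x)%E -> (forall x, f x <= g x)%E ->
  (\int[mu]_x f x = \int[mu]_x g x)%E -> (\int[mu]_x g x < +oo)%E ->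
  ae_eq mu setT f g.
Proof.
move=> mf mg f0 fg ifg goo.
have g0 x : (0 <= g x)%E by exact: le_trans (fg x).
have le_int E : measurable E ->
    (\int[mu]_(x in E) f x <= \int[mu]_(x in E) g x)%E.
  by move=> mE; apply: ge0_le_integral => //; exact: measurable_funTS.
have split_int h : measurable_fun setT h -> (forall x, 0 <= h x)%E ->
    forall E, measurable E ->
    (\int[mu]_x h x = \int[mu]_(x in E) h x + \int[mu]_(x in ~` E) h x)%E.
  move=> mh h0 E mE.
  rewrite -ge0_integral_setU ?setUv//; first exact: measurableC.
  by rewrite disj_set2E setICr.
apply: integral_ae_eq => //.
  apply/integrableP; split => //.
  by under eq_integral do rewrite gee0_abs//; rewrite ifg.
move=> E _ mE; apply/eqP; rewrite eq_le le_int//= leNgt; apply/negP => ltE.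
have mEC := measurableC mE.
have : (\int[mu]_(x in E) f x + \int[mu]_(x in ~` E) f x <
        \int[mu]_(x in E) g x + \int[mu]_(x in ~` E) g x)%E.
  apply: lte_leD => //; last exact: le_int.
  rewrite ge0_fin_numE ?integral_ge0//; apply: le_lt_trans goo.
  rewrite -ifg (split_int _ mf f0 _ mE) leeDr//; exact: integral_ge0.
by rewrite -!split_int// ifg ltxx.
Qed.

End Integration.

(** * Uniqueness of the normalizing potential *)

Section QExponentialFamily.
Context d (T : measurableType d) (R : realType).
Context (nu : {measure set T -> \bar R}) (n : nat) (G : 'I_n -> T -> R) (l : R).
Hypothesis l0 : l != 0.
Hypothesis mG : forall i, measurable_fun [set: T] (G i).

Lemma measurable_dot (theta : 'rV[R]_n) :
  measurable_fun [set: T] (fun x => dot theta (G ^~ x)).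
Proof.
by apply: measurable_sum => i; apply: measurable_funM.
Qed.

Lemma measurable_qexp (q : R) (f : T -> R) : measurable_fun [set: T] f ->
  measurable_fun [set: T] (fun x => qexp q (f x)).
Proof.
move=> mf; apply: (measurableT_comp (measurable_xpow _)).
apply/measurable_EFinP; apply: measurable_maxr => //.
by apply: measurable_funD => //; apply: measurable_funM.
Qed.

(* Raising phi lowers the density strictly wherever it is neither 0 nor +oo, so
   equal integrals would force a density g with g + g = g a.e. *)
Lemma q_potential_inj (theta : 'rV[R]_n) (phi phi' : R) :
  is_q_potential nu G (1 - l) theta phi ->
  is_q_potential nu G (1 - l) theta phi' -> phi = phi'.
Proof.
wlog lt_phi : phi phi' / phi' < phi.
  move=> wl h h'; have [lt|lt|//] := ltgtP phi phi'.
    by apply/esym/wl.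
  exact: wl.
rewrite /is_q_potential; set f := q_exp_density _ _ _ phi.
set g := q_exp_density _ _ _ phi' => f1 g1.
have mq s : measurable_fun setT (q_exp_density G (1 - l) theta s).
  apply: measurable_qexp; apply: measurable_funB => //; exact: measurable_dot.
have f0 x : (0 <= f x)%E by exact: qexp_ge0.
have lt_arg x : dot theta (G ^~ x) - phi < dot theta (G ^~ x) - phi'.
  by rewrite ltrD2l ltrN2.
have fg : ae_eq nu setT f g.
  apply: le_integral_ae_eq; rewrite ?f1 ?g1 ?ltry//; try exact: mq.
  by move=> x; exact: qexp_le.
have : (\int[nu]_x (f x + f x) = \int[nu]_x f x)%E.
  apply: ge0_ae_eq_integral => //.
  - by apply: emeasurable_funD; exact: mq.
  - exact: mq.
  - by move=> x _; rewrite adde_ge0.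
  apply: filterS fg => x /(_ I) fgx _.
  have [|[_ //]] := qexp_lt l0 (lt_arg x).
  by rewrite -[X in (X < _)%E]/(f x) -[X in (_ < X)%E]/(g x) fgx ltxx.
rewrite ge0_integralD//; try exact: mq.
by rewrite f1 -EFinD => -[] /eqP; rewrite -subr_eq0 addrK oner_eq0.
Qed.

End QExponentialFamily.

(** * The mixture family relative to p_0 nu *)

Section MixtureFamily.
Context d (T : measurableType d) (R : realType).
Context (nu : {measure set T -> \bar R}) (n : nat) (lambda : R).
Context (p : 'I_n.+1 -> T -> R).
Hypothesis lambda1 : lambda != 1.
Hypothesis p_density : forall i, is_density nu (p i).
Hypothesis p_wd : lambda_mixture_well_defined nu lambda p.
Hypothesis p0_gt0 : forall x, 0 < p ord0 x.

Let q := 1 - lambda.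
Let q0 : q != 0.
Proof. by rewrite subr_eq0 eq_sym. Qed.
Let qV0 : q^-1 != 0.
Proof. by rewrite invr_eq0. Qed.

Let Z i := fine (\int[nu]_x xpow (p i x)%:E q)%E.

Let mp i : measurable_fun [set: T] (p i).
Proof. by case: (p_density i). Qed.

Let p_ge0 i x : 0 <= p i x.
Proof. by case: (p_density i). Qed.

Let mpq i : measurable_fun [set: T] (fun x => xpow (p i x)%:E q).
Proof.
by apply: (measurableT_comp (measurable_xpow q)); exact/measurable_EFinP.
Qed.

Lemma density_not_ae0 i : ~ {ae nu, forall x, p i x = 0}.
Proof.
move=> pi0; have [_ _] := p_density i.
rewrite (ge0_ae_eq_integral (g := cst 0%E)) ?integral0//.
- by move/eqP; rewrite eq_sym onee_eq0.
- exact/measurable_EFinP.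
- by move=> x _; rewrite lee_fin.
- by apply: filterS pi0 => x /= ->.
Qed.

(** A zero integral would make the power vanish a.e., hence [p i] itself, against its total mass 1.
    This makes the escort normalizers invertible. *)
Lemma integral_xpow_gt0 i : (0 < \int[nu]_x xpow (p i x)%:E q)%E.
Proof.
rewrite lt0e integral_ge0 ?andbT; last by move=> x _; exact: xpow_ge0.
apply/eqP => I0; apply: (@density_not_ae0 i).
have /(ae_eq_integral_abs nu measurableT (mpq i)) :
    (\int[nu]_x `|xpow (p i x)%:E q| = 0)%E.
  by under eq_integral do rewrite gee0_abs ?xpow_ge0//.
by apply: filterS => x /(_ I) /xpow_eq0; apply.
Qed.

Let intZ i : (\int[nu]_x xpow (p i x)%:E q = (Z i)%:E)%E.
Proof.
rewrite fineK// ge0_fin_numE; first exact: p_wd.1.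
by apply: integral_ge0 => x _; exact: xpow_ge0.
Qed.

Let Z_gt0 i : 0 < Z i.
Proof. by rewrite -lte_fin -intZ integral_xpow_gt0. Qed.

(** Real-valued stand-in for the escort: where [p i x = 0] and [q < 0] it is 0 instead of [+oo]. *)
Definition escort_density i x := p i x `^ q / Z i.

Let a := escort_density.

Let a_ge0 i x : 0 <= a i x.
Proof. by rewrite divr_ge0 ?powR_ge0// ltW. Qed.

Let a0_gt0 x : 0 < a ord0 x.
Proof. by rewrite divr_gt0// powR_gt0. Qed.

Let ma i : measurable_fun [set: T] (a i).
Proof.
apply: measurable_funM => //.
exact: (measurableT_comp (measurable_powR _)).
Qed.

(** An integrable power is finite a.e., and there the extended and real powers agree. As there are
    finitely many indices, one null set serves them all. *)
Lemma escort_ae : {ae nu, forall x i, escort nu q (EFin \o p i) x = (a i x)%:E}.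
Proof.
have fin i : {ae nu, forall x, (xpow (p i x)%:E q < +oo)%E}.
  have : nu.-integrable setT (fun x => xpow (p i x)%:E q).
    apply/integrableP; split => //.
    by under eq_integral do rewrite gee0_abs ?xpow_ge0//; exact: p_wd.1.
  move=> /(integrable_ae measurableT); apply: filterS => x /(_ I).
  by rewrite fin_num_abs => /le_lt_trans; apply; exact: lee_abs.
have := filter_forall (ae_filter_ringOfSetsType nu) fin.
apply: filterS => x h i.
rewrite /escort [X in (_ / X)%E]intZ /= xpow_fin//.
by rewrite inver gt_eqF.
Qed.

Definition mixture_statistic (i : 'I_n) (x : T) : R :=
  (a (lift ord0 i) x / a ord0 x - 1) / q.

Let G := mixture_statistic.

Lemma measurable_mixture_statistic i : measurable_fun [set: T] (G i).
Proof.
apply: measurable_funM => //; apply: measurable_funB => //.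
apply: measurable_funM => //.
have -> : (fun x => (a ord0 x)^-1) = (fun x => a ord0 x `^ (-1)).
  by apply/funext => x; rewrite powR_inv1.
exact: (measurableT_comp (measurable_powR _)).
Qed.

Definition mixture_parameter (eta : 'rV[R]_n.+1) : 'rV[R]_n :=
  \row_i eta 0 (lift ord0 i).

Let vt := mixture_parameter.

Lemma bracket_mixture eta x : simplex eta ->
  a ord0 x * (1 + q * dot (vt eta) (G ^~ x)) = \sum_i eta 0 i * a i x.
Proof.
(* The weight of index 0 is replaced by 1 minus the sum of the others. *)
case=> _; rewrite !big_ord_recl => /eqP; rewrite eq_sym -subr_eq => /eqP <-.
rewrite /dot mulr_sumr mulrDr mulr1 mulrBl mul1r -addrA; congr (_ + _).
rewrite addrC mulr_sumr mulr_suml -sumrB; apply: eq_bigr => i _.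
have cancel_qa (k u v e : R) : k != 0 -> v != 0 ->
    v * (k * (e * ((u / v - 1) / k))) = e * u - e * v.
  by move=> k0 v0; field; rewrite k0 v0.
by rewrite [vt eta 0 i]mxE; apply: cancel_qa => //; exact: lt0r_neq0.
Qed.

(** The proportionality constant between a_0^(1/q) and p_0; it cancels on normalization. *)
Let c := (Z ord0) `^ (- q^-1).

Let c_gt0 : 0 < c. Proof. exact: powR_gt0. Qed.

Lemma a0_powR x : a ord0 x `^ q^-1 = c * p ord0 x.
Proof.
rewrite /a /escort_density powRM ?powR_ge0 ?invr_ge0 ?(ltW (Z_gt0 _))//.
rewrite -powRrM divff// powRr1// mulrC; congr (_ * _).
by rewrite -(powR_inv1 (ltW (Z_gt0 _))) -powRrM mulN1r.
Qed.

Lemma xpow_mixture_ae eta : simplex eta ->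
  {ae nu, forall x, xpow (escort_mixture nu lambda p eta x) q^-1 =
    (c%:E * ((p ord0 x)%:E * qexp (1 - q) (dot (vt eta) (G ^~ x))))%E}.
Proof.
move=> eta1; apply: filterS escort_ae => x h.
have -> : escort_mixture nu lambda p eta x = (\sum_i eta 0 i * a i x)%:E.
  by rewrite -sumEFin; apply: eq_bigr => i _; rewrite h.
(* The bracket is a nonnegative mixture divided by a_0 > 0, so the truncation in [qexp] is
   inactive. *)
have bge0 : 0 <= 1 + q * dot (vt eta) (G ^~ x).
  rewrite -(pmulr_rge0 _ (a0_gt0 x)) bracket_mixture//.
  by apply: sumr_ge0 => i _; rewrite mulr_ge0//; case: eta1.
rewrite -bracket_mixture// xpowM// a0_powR qexp_compl max_l//.
by rewrite EFinM muleA.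
Qed.

Lemma measurable_escort_mixture eta :
  measurable_fun [set: T] (escort_mixture nu lambda p eta).
Proof.
apply: emeasurable_sum => i; apply: measurable_funeM.
rewrite /escort.
under eq_fun do rewrite muleC.
by apply: measurable_funeM; exact: mpq.
Qed.

(** Some weight [eta 0 k] is positive. If the integral were 0, the mixture would vanish a.e.; its
    terms being nonnegative, [p k] would vanish a.e. as well. *)
Lemma integral_mixture_gt0 eta : simplex eta ->
  (0 < \int[nu]_x xpow (escort_mixture nu lambda p eta x) q^-1)%E.
Proof.
move=> eta1.
rewrite lt0e integral_ge0 ?andbT; last by move=> x _; exact: xpow_ge0.
apply/eqP => I0.
have [k etak] : exists k, 0 < eta 0 k.
  apply/existsP; apply: contraT; rewrite negb_exists => /forallP eta0.
  case: eta1 => eta_ge0; rewrite big1 => [/eqP|i _].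
    by rewrite eq_sym oner_eq0.
  by apply/eqP; move: (eta0 i); rewrite -leNgt eq_le eta_ge0 => ->.
apply: (@density_not_ae0 k).
have mM : measurable_fun setT
    (fun x => xpow (escort_mixture nu lambda p eta x) q^-1).
  exact: (measurableT_comp (measurable_xpow _) (measurable_escort_mixture eta)).
have /(ae_eq_integral_abs nu measurableT mM) :
    (\int[nu]_x `|xpow (escort_mixture nu lambda p eta x) q^-1| = 0)%E.
  by under eq_integral do rewrite gee0_abs ?xpow_ge0//.
move=> M0; near=> x.
have h : forall i, escort nu q (EFin \o p i) x = (a i x)%:E.
  by near: x; exact: escort_ae.
have : xpow (escort_mixture nu lambda p eta x) q^-1 = 0%E.
  by near: x; apply: filterS M0 => x /(_ I).
have -> : escort_mixture nu lambda p eta x = (\sum_i eta 0 i * a i x)%:E.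
  by rewrite -sumEFin; apply: eq_bigr => i _; rewrite h.
have t_ge0 i : 0 <= eta 0 i * a i x by rewrite mulr_ge0//; case: eta1.
move=> /xpow_eq0 => /(_ (sumr_ge0 _ (fun i _ => t_ge0 i))) /eqP.
rewrite psumr_eq0// => /allP /(_ k (mem_index_enum _)) /=.
rewrite mulf_eq0 gt_eqF//= mulf_eq0 invr_eq0 (gt_eqF (Z_gt0 _)) orbF.
by move=> /eqP /powR_eq0_eq0.
Unshelve. all: by end_near. Qed.

(** Here nu' = p_0 nu, and [K] is the integral of the unnormalized deformed exponential. The mixture
    normalizer equals c K, so [K] inherits positivity and finiteness from it. *)
Lemma mixture_is_exponential :
  exists nu' : {measure set T -> \bar R}, forall eta, simplex eta ->
    exists K : R, [/\ 0 < K,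
      (\int[nu']_x qexp (1 - q) (dot (vt eta) (G ^~ x)) = K%:E)%E &
      forall A, measurable A ->
        (\int[nu]_(x in A) lambda_mixture nu lambda p eta x =
         \int[nu']_(x in A)
           (qexp (1 - q) (dot (vt eta) (G ^~ x)) * (K^-1)%:E))%E].
Proof.
have [nu' nu'E] := exists_density_measure nu (mp ord0) (p_ge0 ord0).
exists nu' => eta eta1; pose E x := qexp (1 - q) (dot (vt eta) (G ^~ x)).
have mE : measurable_fun setT E.
  apply: measurable_qexp; apply: measurable_dot => i.
  exact: measurable_mixture_statistic.
have E_ge0 x : (0 <= E x)%E by exact: qexp_ge0.
have mp0 : measurable_fun setT (EFin \o p ord0) by exact/measurable_EFinP.
have mpE : measurable_fun setT (fun x => (p ord0 x)%:E * E x)%E.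
  exact: emeasurable_funM.
have pE_ge0 x : (0 <= (p ord0 x)%:E * E x)%E by rewrite mule_ge0// lee_fin.
have mM : measurable_fun setT
    (fun x => xpow (escort_mixture nu lambda p eta x) q^-1).
  exact: (measurableT_comp (measurable_xpow _) (measurable_escort_mixture eta)).
have M_E := xpow_mixture_ae eta1.
have NE : (\int[nu]_x xpow (escort_mixture nu lambda p eta x) q^-1 =
           c%:E * \int[nu']_x E x)%E.
  rewrite nu'E// -ge0_integralZl//; last by rewrite lee_fin ltW.
  apply: ge0_ae_eq_integral => //.
  - exact: measurable_funeM.
  - by move=> x _; exact: xpow_ge0.
  - by move=> x _; rewrite mule_ge0// lee_fin ltW.
  - by apply: filterS M_E.
have := integral_mixture_gt0 eta1; have := p_wd.2 _ eta1.
rewrite NE; have : (0 <= \int[nu']_x E x)%E by exact: integral_ge0.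
(* An infinite integral would make the mixture normalizer infinite, against well-definedness; this
   case is closed last. *)
case EK : (\int[nu']_x E x)%E NE => [K||] // NE _.
  move=> _; rewrite -EFinM lte_fin pmulr_rgt0// => K0.
  exists K; split => // A mA.
  rewrite nu'E//; last 2 first.
  - by under eq_fun do rewrite muleC; exact: measurable_funeM.
  - by move=> x; rewrite mule_ge0 ?qexp_ge0// lee_fin invr_ge0 ltW.
  have VE : (\int[nu]_x xpow (escort_mixture nu lambda p eta x) q^-1)^-1%E
            = ((c * K)^-1)%:E.
    by rewrite NE -EFinM inver gt_eqF// mulr_gt0.
  apply: ge0_ae_eq_integral => //.
  - rewrite /lambda_mixture /escort.
    under eq_fun do rewrite muleC.
    by apply: measurable_funTS; exact: measurable_funeM.
  - under eq_fun do rewrite muleA muleC.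
    by apply: measurable_funTS; exact: measurable_funeM.
  - move=> x _; rewrite /lambda_mixture /escort mule_ge0 ?xpow_ge0//.
    by rewrite [X in (_ <= X)%E]VE lee_fin invr_ge0 ltW// mulr_gt0.
  - move=> x _; rewrite mule_ge0 ?lee_fin// mule_ge0 ?qexp_ge0//.
    by rewrite lee_fin invr_ge0 ltW.
  - apply: filterS M_E => x ME _.
    rewrite /lambda_mixture /escort VE ME [RHS]muleA muleC muleA -EFinM.
    by rewrite invfM mulrC mulrA divff ?gt_eqF// mul1r muleC.
by rewrite gt0_muley ?lte_fin// ltxx.
Qed.

End MixtureFamily.

(** * The two parameterizations and their injectivity *)

Theorem corollary4p13 (disp : measure_display) (T : measurableType disp)
  (R : realType) (nu : {measure set T -> \bar R}) (d : nat)
  (lambda lambda' q' : R) (p : 'I_d.+1 -> T -> R)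
  (hlambda : lambda != 1)
  (hp : forall i, is_density nu (p i))
  (hwd : lambda_mixture_well_defined nu lambda p)
  (hp0 : forall x, 0 < p ord0 x)
  (hlambda' : lambda' = 1 - lambda)
  (hq' : q' = 1 - lambda') :
  exists (nu' : {measure set T -> \bar R}) (G : 'I_d -> T -> R)
         (vartheta theta : 'rV[R]_d.+1 -> 'rV[R]_d),
    [/\ forall i, measurable_fun [set: T] (G i),
        set_inj (simplex (n := d)) vartheta,
        set_inj (simplex (n := d)) theta &
        forall eta, simplex eta ->
          exists phil phiq : R,
            [/\ lambda_potential nu' G lambda' (vartheta eta) = phil%:E,
                unique (is_q_potential nu' G q' (theta eta)) phiq,
                (forall x, lambda_exp_density G lambda' (vartheta eta) phil x =
                           q_exp_density G q' (theta eta) phiq x) &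
                forall A, measurable A ->
                  (\int[nu]_(x in A) lambda_mixture nu lambda p eta x =
                   \int[nu']_(x in A)
                     lambda_exp_density G lambda' (vartheta eta) phil x)%E]].
Proof.
subst q' lambda'; set q := 1 - lambda.
have q0 : q != 0 by rewrite subr_eq0 eq_sym.
have [nu' nu'P] := mixture_is_exponential hlambda hp hwd hp0.
pose G := mixture_statistic nu lambda p.
have mG i : measurable_fun setT (G i) by exact: measurable_mixture_statistic.
pose vt := @mixture_parameter R d.
pose phi eta := fine (lambda_potential nu' G q (vt eta)).
(* [r], [th] and [phiq] are read off from [qexp_mul_expR] applied with potential [phi eta]. *)
pose r eta := expR (- (q * phi eta)).
have r_gt0 eta : 0 < r eta by exact: expR_gt0.
pose th eta := r eta *: vt eta.
pose phiq eta := (1 - r eta) / q.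
have potE eta : simplex eta -> lambda_potential nu' G q (vt eta) = (phi eta)%:E.
  move=> /nu'P[K [K0 EK _]].
  by rewrite /phi /lambda_potential [X in lne X]EK lne_EFin.
have densE eta x : lambda_exp_density G q (vt eta) (phi eta) x =
    q_exp_density G (1 - q) (th eta) (phiq eta) x.
  rewrite /lambda_exp_density /q_exp_density qexp_mul_expR//.
  congr (qexp _ (_ - _)); rewrite /dot mulr_sumr.
  by apply: eq_bigr => i _; rewrite [th eta 0 i]mxE mulrA.
have mixE eta : simplex eta -> forall A, measurable A ->
    (\int[nu]_(x in A) lambda_mixture nu lambda p eta x =
     \int[nu']_(x in A) lambda_exp_density G q (vt eta) (phi eta) x)%E.
  move=> eta1 A mA; have [K [K0 EK ->//]] := nu'P _ eta1.
  apply: eq_integral => x _; rewrite /lambda_exp_density; congr (_ * _%:E)%E.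
  rewrite /phi /lambda_potential [X in lne X]EK lne_EFin//=.
  by rewrite expRN lnK.
have qpot eta : simplex eta -> is_q_potential nu' G (1 - q) (th eta) (phiq eta).
  move=> eta1; have [K [K0 EK _]] := nu'P _ eta1.
  rewrite /is_q_potential; under eq_integral do rewrite -densE.
  rewrite /lambda_exp_density; under eq_integral do rewrite muleC.
  rewrite ge0_integralZl//.
  - rewrite [X in (_ * X)%E]EK /phi /lambda_potential [X in lne X]EK.
    by rewrite lne_EFin//= expRN lnK// -EFinM mulVf// gt_eqF.
  - by apply: measurable_qexp; exact: measurable_dot.
  - by move=> x _; exact: qexp_ge0.
have vt_inj : set_inj (simplex (n := d)) vt.
  move=> eta eta' /set_mem[_ s1] /set_mem[_ s1'] /rowP vtE.
  have tailE i : eta 0 (lift ord0 i) = eta' 0 (lift ord0 i).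
    by have := vtE i; rewrite !mxE.
  (* The dropped coordinate 0 is recovered from the weights summing to 1. *)
  apply/rowP => i; case: (unliftP ord0 i) => [j|] ->; first exact: tailE.
  move: s1; rewrite -s1' !big_ord_recl.
  by under eq_bigr do rewrite tailE; move=> /addIr.
exists nu', G, vt, th; split => //.
  move=> eta eta' /[dup] /set_mem s /[swap] /[dup] /set_mem s' es' es thE.
  apply: vt_inj => //.
  have phiqE : phiq eta = phiq eta'.
    apply: (q_potential_inj (l := q) q0 mG (qpot _ s)).
    by rewrite thE; exact: qpot.
  (* Equal potentials (1 - r)/q give equal scale factors, and the common nonzero factor then cancels
     from [th]. *)
  have rE : r eta = r eta'.
    by move: phiqE => /(mulIf (invr_neq0 q0)) /subrI.
  have : r eta *: vt eta = r eta' *: vt eta' := thE.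
  by rewrite rE; exact: scalerI (lt0r_neq0 (r_gt0 _)) _ _.
move=> eta eta1; exists (phi eta), (phiq eta); split => //.
- exact: potE.
- split; first exact: qpot.
  by move=> phi' h; apply: (q_potential_inj (l := q) q0 mG (qpot _ eta1) h).
- exact: mixE.
Qed.
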